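(* In the three-seasonal discrete-time risk model, for each $u\in\mathbb{N}_0$ we have \[ \psi^{(0)}(u,1)=\sum_{k>u}a_k,\qquad \psi^{(1)}(u,1)=\sum_{k>u}b_k,\qquad \psi^{(2)}(u,1)=\sum_{k>u}c_k, \] and for all $u\in\mathbb{N}_0$ and all $T\in\{2,3,\ldots\}$ the following recursive formulas hold: \begin{align*} \psi^{(0)}(u,T)&=\psi^{(0)}(u,1)+\sum_{k=0}^{u}\psi^{(1)}(u+1-k,T-1)\,a_k,\\ \psi^{(1)}(u,T)&=\psi^{(1)}(u,1)+\sum_{k=0}^{u}\psi^{(2)}(u+1-k,T-1)\,b_k,\\ \psi^{(2)}(u,T)&=\psi^{(2)}(u,1)+\sum_{k=0}^{u}\psi^{(0)}(u+1-k,T-1)\,c_k. \end{align*}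
   Context: $\mathbb{N}_0=\{0,1,2,\ldots\}$, $\mathbb{N}=\{1,2,\ldots\}$. Three-seasonal discrete-time risk model: $Z_1,Z_2,\ldots$ are independent nonnegative integer-valued random variables such that for all $k\in\mathbb{N}_0$, $Z_{3k+1}$ has the same distribution as $Z_1$, $Z_{3k+2}$ has the same distribution as $Z_2$, and $Z_{3k+3}$ has the same distribution as $Z_3$. For initial surplus $u\in\mathbb{N}_0$ the insurer's surplus at time $n\in\mathbb{N}_0$ is $W_u(n)=u+n-\sum_{i=1}^{n}Z_i$. Notation: $a_k=\mathbb{P}(Z_1=k)$, $b_k=\mathbb{P}(Z_2=k)$, $c_k=\mathbb{P}(Z_3=k)$ for $k\in\mathbb{N}_0$. For $j\in\mathbb{N}_0$, $u\in\mathbb{N}_0$, $T\in\mathbb{N}$, \[ \psi^{(j)}(u,T)=\mathbb{P}\Biggl(\bigcup_{n=1}^{T}\Biggl\{u+n-\sum_{i=1}^{n}Z_{i+j}\leqslant 0\Biggr\}\Biggr). \] (In particular $\psi^{(0)}(u,T)$ is the finite-time ruin probability of the model until time $T$.) *)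

(* Defs.v *)
(* MathComp-Analysis. *)
From mathcomp Require Import all_boot all_order all_algebra finmap.
From mathcomp Require Import all_classical all_reals all_analysis.

Set Implicit Arguments.
Unset Strict Implicit.
Unset Printing Implicit Defensive.

Import Order.TTheory GRing.Theory Num.Theory.

Local Open Scope classical_set_scope.
Local Open Scope ring_scope.

(* Mutual independence of the subfamily (X i)_(i in D): the product rule over
   all finite subfamilies and all measurable sets. *)
Definition mutually_independent (d d' : measure_display)
    (Omega : measurableType d) (E : measurableType d') (R : realType)
    (P : probability Omega R) (I : choiceType) (D : set I)
    (X : I -> {RV P >-> E}) : Prop :=
  forall (J : {fset I}) (A : I -> set E),
    [set` J] `<=` D ->
    (forall i, i \in J -> measurable (A i)) ->
    P (\bigcap_(i in [set` J]) (X i @^-1` A i)) =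
    (\prod_(i <- J) P (X i @^-1` A i))%E.

Definition identically_distributed (d d' : measure_display)
    (Omega : measurableType d) (E : measurableType d') (R : realType)
    (P : probability Omega R) (X Y : {RV P >-> E}) : Prop :=
  forall A : set E, measurable A -> distribution P X A = distribution P Y A.

(* The claims are Z 1, Z 2, ...; the index 0 is a dummy, left unconstrained
   and never used. *)
Definition three_seasonal (d : measure_display) (Omega : measurableType d)
    (R : realType) (P : probability Omega R)
    (Z : nat -> {RV P >-> nat}) : Prop :=
  mutually_independent [set i | (0 < i)%N] Z /\
  forall k : nat,
    [/\ identically_distributed (Z (3 * k + 1)%N) (Z 1%N),
        identically_distributed (Z (3 * k + 2)%N) (Z 2%N) &
        identically_distributed (Z (3 * k + 3)%N) (Z 3%N)].

(* Surplus at time n, as a signed integer, when the first claim is Z (j + 1);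
   W_u(n) is the case j = 0. *)
Definition surplus (d : measure_display) (Omega : measurableType d)
    (R : realType) (P : probability Omega R)
    (Z : nat -> {RV P >-> nat}) (j u n : nat) (w : Omega) : int :=
  u%:Z + n%:Z - \sum_(1 <= i < n.+1) (Z (i + j)%N w)%:Z.

Definition psi (d : measure_display) (Omega : measurableType d)
    (R : realType) (P : probability Omega R)
    (Z : nat -> {RV P >-> nat}) (j u T : nat) : \bar R :=
  P (\bigcup_(n in [set n | (1 <= n <= T)%N])
       [set w | surplus Z j u n w <= 0]).

(* The library's pmf only covers real-valued random variables. *)
Definition claim_pmf (d : measure_display) (Omega : measurableType d)
    (R : realType) (P : probability Omega R)
    (X : {RV P >-> nat}) (k : nat) : \bar R :=
  P [set w | X w = k].

(* Main.v *)
(* Conditioning on the first claim: a claim above u ruins at once, and a claim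
   k <= u restarts the model one season later with surplus u + 1 - k.  By
   induction on the horizon, this decomposition shows that ruin after time j
   is independent of the claims up to time j, so psi factors at each step;
   it also shows that psi depends on the claims only through their marginal
   laws, which gives psi^(3) = psi^(0) from periodicity. *)
Require Import Defs.
From mathcomp Require Import all_boot all_order all_algebra.
From mathcomp Require Import all_classical all_reals all_analysis.
From mathcomp Require Import finmap zify.
Set Implicit Arguments.
Unset Strict Implicit.
Unset Printing Implicit Defensive.
Import Order.TTheory GRing.Theory Num.Theory.
Local Open Scope ereal_scope.

Section MutualIndependence.
Local Open Scope classical_set_scope.

Lemma mutually_independentI (d d' : measure_display)
    (Omega : measurableType d) (E : measurableType d') (R : realType)
    (P : probability Omega R) (I : choiceType) (D : set I)
    (X : I -> {RV P >-> E}) (J : {fset I}) (A : I -> set E) (i : I)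
    (B : set E) :
  mutually_independent D X -> [set` J] `<=` D -> D i -> i \notin J ->
  (forall l, l \in J -> measurable (A l)) -> measurable B ->
  P (\bigcap_(l in [set` J]) (X l @^-1` A l) `&` X i @^-1` B) =
  P (\bigcap_(l in [set` J]) (X l @^-1` A l)) * P (X i @^-1` B).
Proof.
move=> indX JD Di iJ mA mB.
pose A' l := if l == i then B else A l.
have A'J l : l \in J -> A' l = A l.
  by move=> lJ; rewrite /A'; case: eqP => // li; rewrite -li lJ in iJ.
have A'i : A' i = B by rewrite /A' eqxx.
have := indX (i |` J)%fset A'.
rewrite bigcap_fsetU1 big_fsetU1//= A'i.
rewrite (@eq_bigcapr _ _ [set` J] _ (fun l => X l @^-1` A l)); last first.
  by move=> l /= lJ; rewrite A'J.
rewrite big_seq (eq_bigr (fun l => P (X l @^-1` A l))); last first.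
  by move=> l lJ; rewrite A'J.
rewrite -big_seq setIC => ->.
- by rewrite (indX J A)// muleC.
- by rewrite set_fsetU1 => l [->|/JD].
- by move=> l; rewrite !inE /A'; case: eqP => //= _; exact: mA.
Qed.

Lemma identically_distributed_claim_pmf (d : measure_display)
    (Omega : measurableType d) (R : realType) (P : probability Omega R)
    (X Y : {RV P >-> nat}) :
  identically_distributed X Y -> claim_pmf X = claim_pmf Y.
Proof. by move=> XY; apply/funext => k; exact: (XY [set k]). Qed.

End MutualIndependence.

Section Ruin.
Local Open Scope classical_set_scope.
Context (d : measure_display) (Omega : measurableType d) (R : realType)
  (P : probability Omega R) (Z : nat -> {RV P >-> nat}).

Definition ruin (j u T : nat) : set Omega :=
  \bigcup_(n in [set n | (1 <= n <= T)%N])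
    [set w | (surplus Z j u n w <= 0)%R].

Lemma psiE j u T : psi Z j u T = P (ruin j u T). Proof. by []. Qed.

Lemma ruin0 j u : ruin j u 0 = set0.
Proof. by rewrite /ruin bigcup0// => n /=; case: n. Qed.

(** Split off the first claim and reindex the others. The bound on [k] makes the truncated
    subtraction [u + 1 - k] exact. *)
Lemma surplusS j u n k w : Z j.+1 w = k -> (k <= u)%N ->
  surplus Z j u n.+1 w = surplus Z j.+1 (u + 1 - k) n w.
Proof.
move=> Zk ku; rewrite /surplus big_nat_recl//= add1n Zk.
under eq_bigr do rewrite addSnnS.
by set s := (\sum_(_ <= _ < _) _)%R; lia.
Qed.

Lemma surplus1 j u w : (surplus Z j u 1 w <= 0)%R = (u < Z j.+1 w)%N.
Proof. by rewrite /surplus big_nat1 add1n; lia. Qed.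

Lemma ruinS j u T : ruin j u T.+1 =
  Z j.+1 @^-1` [set z | (u < z)%N] `|`
  \big[setU/set0]_(k < u.+1) (Z j.+1 @^-1` [set nat_of_ord k] `&`
                              ruin j.+1 (u + 1 - k) T).
Proof.
rewrite -(bigcup_mkord u.+1 (fun k => Z j.+1 @^-1` [set k] `&`
                              ruin j.+1 (u + 1 - k) T)).
apply/seteqP; split => w.
- move=> [n /= nT sn]; have [Zu|uZ] := leqP (Z j.+1 w) u; last by left.
  right; exists (Z j.+1 w) => //=; split => //.
  (* Time 1 is excluded: a first claim of at most [u] leaves a positive surplus. *)
  case: n => [//|[|n]] in nT sn *; first by move: sn; rewrite surplus1; lia.
  exists n.+1; first by rewrite /=; lia.
  by rewrite /= -(@surplusS j u _ _ w).
- case=> [/= uZ|[k /= ku [/= Zk [n /= nT sn]]]].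
    by exists 1%N => //=; rewrite surplus1.
  exists n.+1; first by rewrite /=; lia.
  by rewrite /= (surplusS _ Zk).
Qed.

Lemma measurable_claim i (B : set nat) : measurable (Z i @^-1` B).
Proof. exact: measurable_funPTI. Qed.

Lemma measurable_ruin j u T : measurable (ruin j u T).
Proof.
elim: T j u => [|T IH] j u; first by rewrite ruin0.
rewrite ruinS; apply: measurableU; first exact: measurable_claim.
by apply: bigsetU_measurable => k _; apply: measurableI => //;
  exact: measurable_claim.
Qed.

(** The pieces of [ruinS] are disjoint, since they fix different values of the first claim. The
    event [G] is carried along to hold past claims; [G = setT] gives the unconditional formula. *)
Lemma probability_ruinS (G : set Omega) j u T : measurable G ->
  P (G `&` ruin j u T.+1) =
  P (G `&` Z j.+1 @^-1` [set z | (u < z)%N]) +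
  \sum_(0 <= k < u.+1)
    P (G `&` Z j.+1 @^-1` [set k] `&` ruin j.+1 (u + 1 - k) T).
Proof.
move=> mG.
pose F k := G `&` Z j.+1 @^-1` [set k] `&` ruin j.+1 (u + 1 - k) T.
have mF k : measurable (F k).
  apply: measurableI; last exact: measurable_ruin.
  by apply: measurableI => //; exact: measurable_claim.
have tF : trivIset setT F.
  by move=> k l _ _ [w [[[_ /= <-] _] [[_ /= <-] _]]].
rewrite big_mkord -(measure_bigsetU P mF tF) ruinS setIUr.
rewrite big_distrr/= (eq_bigr (fun k : 'I_u.+1 => F k)); last first.
  by move=> k _; rewrite setIA.
apply: measureU.
- by apply: measurableI => //; exact: measurable_claim.
- by apply: bigsetU_measurable => k _.
rewrite -(bigcup_mkord u.+1 F) -subset0 => w [[_ /= uZ]].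
by move=> [k /= ku [[_ /= Zk] _]]; lia.
Qed.

Lemma probability_claim_gt i u :
  P (Z i @^-1` [set z | (u < z)%N]) = \sum_(u.+1 <= k <oo) claim_pmf (Z i) k.
Proof.
pose F k := Z i @^-1` [set k].
have -> : Z i @^-1` [set z | (u < z)%N] = \bigcup_(k in [set k | (u < k)%N]) F k.
  apply/seteqP; split => w /=; first by move=> uZ; exists (Z i w).
  by move=> [k /= uk Zk]; rewrite Zk.
rewrite measure_bigcup.
- by rewrite [RHS]eseries_cond; apply: eq_eseriesl => k; rewrite mem_setE.
- by move=> k _; exact: measurable_claim.
- by move=> k l _ _ [w [/= <- <-]].
Qed.

Hypothesis indZ : mutually_independent [set i | (0 < i)%N] Z.

(** Induction on the horizon, with [J] and [A] general: after one season the event that claim [j.+1]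
    equals [k] joins the past, and the induction hypothesis applies at [j.+1]. *)
Lemma ruin_indep_past (J : {fset nat}) (A : nat -> set nat) j u T :
  (forall i, i \in J -> (0 < i <= j)%N) ->
  P (\bigcap_(i in [set` J]) (Z i @^-1` A i) `&` ruin j u T) =
  P (\bigcap_(i in [set` J]) (Z i @^-1` A i)) * psi Z j u T.
Proof.
elim: T j u J A => [|T IH] j u J A Jj; rewrite psiE.
  by rewrite ruin0 setI0 measure0 mule0.
set G := \bigcap_(i in _) _.
have mG : measurable G.
  by apply: fin_bigcap_measurable => // i _; exact: measurable_claim.
have jJ : j.+1 \notin J by apply/negP => /Jj; rewrite ltnn andbF.
have JD : [set` J] `<=` [set i | (0 < i)%N] by move=> i /Jj /andP[].
have indG B : P (G `&` Z j.+1 @^-1` B) = P G * P (Z j.+1 @^-1` B).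
  by apply: (mutually_independentI (A := A) indZ JD).
(* Stated for any past family because it is used twice: with [J] on the left side, and with the
   empty family to expand [psi] on the right. *)
have step (J' : {fset nat}) (A' : nat -> set nat) k :
    (forall i, i \in J' -> (0 < i <= j)%N) ->
  P (\bigcap_(i in [set` J']) (Z i @^-1` A' i) `&` Z j.+1 @^-1` [set k] `&`
     ruin j.+1 (u + 1 - k) T) =
  P (\bigcap_(i in [set` J']) (Z i @^-1` A' i) `&` Z j.+1 @^-1` [set k]) *
  psi Z j.+1 (u + 1 - k) T.
  move=> J'j.
  pose A1 i := if i == j.+1 then [set k] else A' i.
  have A1j : A1 j.+1 = [set k] by rewrite /A1 eqxx.
  have A1J : \bigcap_(i in [set` J']) (Z i @^-1` A1 i) =
             \bigcap_(i in [set` J']) (Z i @^-1` A' i).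
    apply: eq_bigcapr => i /= /J'j /andP[_ ij]; rewrite /A1.
    by rewrite ltn_eqF.
  rewrite -A1J -A1j [X in X `&` _]setIC
    [X in _ = P X * _]setIC -(bigcap_fsetU1 (fun i => Z i @^-1` A1 i)).
  by apply: IH => i /fset1UP[->|/J'j]; lia.
rewrite probability_ruinS// indG.
under eq_bigr => k _ do rewrite step// indG -muleA.
rewrite -(setTI (ruin j u T.+1)) probability_ruinS// setTI.
rewrite ge0_muleDr//; last first.
  by apply: sume_ge0 => k _; exact: measure_ge0.
congr (_ + _); rewrite ge0_sume_distrr//; apply: eq_bigr => k _.
(* The empty intersection is [setT], so this factors the terms in the expansion of [psi] itself. *)
have := @step fset0 (fun=> setT) k.
rewrite set_fset0 bigcap_set0 => ->//.
by rewrite setTI.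
Qed.

(** Valid also for [T = 0], where the sum vanishes because ruin within horizon 0 is impossible; this
    yields [psi1]. *)
Lemma psi_recS j u T : psi Z j u T.+1 =
  P (Z j.+1 @^-1` [set z | (u < z)%N]) +
  \sum_(0 <= k < u.+1) psi Z j.+1 (u + 1 - k) T * claim_pmf (Z j.+1) k.
Proof.
rewrite psiE -(setTI (ruin _ _ _)) probability_ruinS// setTI.
congr (_ + _); apply: eq_bigr => k _.
have := @ruin_indep_past [fset j.+1]%fset (fun=> [set k]) j.+1 (u + 1 - k) T.
rewrite set_fset1 bigcap_set1 setTI => ->; first by rewrite muleC.
by move=> i; rewrite inE => /eqP ->; rewrite leqnn.
Qed.

Lemma psi1 j u : psi Z j u 1 = \sum_(u.+1 <= k <oo) claim_pmf (Z j.+1) k.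
Proof.
rewrite psi_recS big1 ?adde0 ?probability_claim_gt// => k _.
by rewrite psiE ruin0 measure0 mul0e.
Qed.

Lemma psi_rec j u T : (2 <= T)%N -> psi Z j u T = psi Z j u 1 +
  \sum_(0 <= k < u.+1) psi Z j.+1 (u + 1 - k) (T - 1) * claim_pmf (Z j.+1) k.
Proof.
case: T => [//|T] _.
by rewrite psi_recS psi1 probability_claim_gt subSS subn0.
Qed.

(** By [psi_recS], [psi] at [j] is determined by the mass functions of the claims after [j].
    Restricting the hypothesis to [j < i] keeps the dummy claim [Z 0] out. *)
Lemma psi_shift p j u T :
  (forall i, (j < i)%N -> claim_pmf (Z (i + p)) = claim_pmf (Z i)) ->
  psi Z (j + p) u T = psi Z j u T.
Proof.
elim: T j u => [|T IH] j u periodic; first by rewrite !psiE !ruin0.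
rewrite !psi_recS !probability_claim_gt -addSn periodic//.
congr (_ + _); apply: eq_bigr => k _; rewrite IH// => i ji.
by apply: periodic; exact: ltnW.
Qed.

End Ruin.

Lemma three_seasonal_claim_pmf (d : measure_display)
    (Omega : measurableType d) (R : realType) (P : probability Omega R)
    (Z : nat -> {RV P >-> nat}) (i : nat) :
  three_seasonal Z -> (0 < i)%N -> claim_pmf (Z (i + 3)%N) = claim_pmf (Z i).
Proof.
move=> [_ season] i0.
have eqd k r : (r = 1 \/ r = 2 \/ r = 3)%N ->
    claim_pmf (Z (3 * k + r)%N) = claim_pmf (Z r).
  have [s1 s2 s3] := season k.
  by move=> [|[|]] ->; exact: identically_distributed_claim_pmf.
(* Dividing [i.-1] instead of [i] makes [r] range over 1, 2, 3, as the seasons are numbered. *)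
pose k := (i.-1 %/ 3)%N; pose r := (i.-1 %% 3).+1.
have r3 : (r = 1 \/ r = 2 \/ r = 3)%N by rewrite /r; lia.
have ikr : i = (3 * k + r)%N by rewrite /k /r; lia.
have -> : (i + 3)%N = (3 * k.+1 + r)%N by lia.
by rewrite ikr !eqd.
Qed.

Theorem theorem3 (d : measure_display) (Omega : measurableType d)
    (R : realType) (P : probability Omega R) (Z : nat -> {RV P >-> nat})
    (hZ : three_seasonal Z) :
  let a := claim_pmf (Z 1%N) in
  let b := claim_pmf (Z 2%N) in
  let c := claim_pmf (Z 3%N) in
  (forall u : nat,
    [/\ psi Z 0 u 1 = \sum_(u.+1 <= k <oo) a k,
        psi Z 1 u 1 = \sum_(u.+1 <= k <oo) b k &
        psi Z 2 u 1 = \sum_(u.+1 <= k <oo) c k]) /\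
  (forall u T : nat, (2 <= T)%N ->
    [/\ psi Z 0 u T =
          psi Z 0 u 1 + \sum_(0 <= k < u.+1) psi Z 1 (u + 1 - k) (T - 1) * a k,
        psi Z 1 u T =
          psi Z 1 u 1 + \sum_(0 <= k < u.+1) psi Z 2 (u + 1 - k) (T - 1) * b k &
        psi Z 2 u T =
          psi Z 2 u 1 + \sum_(0 <= k < u.+1) psi Z 0 (u + 1 - k) (T - 1) * c k]).
Proof.
have [indZ _] := hZ.
split => [u|u T T2]; first by split; exact: psi1.
split; [exact: psi_rec|exact: psi_rec|].
(* The recursion leads to [psi Z 3], which the period 3 identifies with [psi Z 0]. *)
rewrite psi_rec//; congr (_ + _); apply: eq_bigr => k _.
rewrite -(psi_shift indZ (p := 3) (j := 0))// => i.
exact: three_seasonal_claim_pmf.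
Qed.
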